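(* Assume that $G$ is Fréchet differentiable with Lipschitz continuous gradient (constant $L_G>0$) and strongly convex with coercivity constant $\alpha_G>0$, and that there is $\alpha_B>0$ with $\|B'\mu\|_X\ge\alpha_B\|\mu\|_Y$ for all $\mu\in Y$. Let $(u,p;\lambda)$ be a saddle point of $\mathcal{L}_\tau$, let $(u^j,p^j;\lambda^j)$, $j\ge0$, be the iterates of the Generalized ADMM (defined in the context), and set $$D_j^2=\|\lambda-\lambda^j\|_Y^2+\tau_j^2\|B(u-u^j)\|_Y^2,\qquad j\ge0 .$$ If $\underline{\tau}\le\tau_{j+1}\le\tau_j\le\overline{\tau}$ for all $j\ge0$, then there exist a sequence $(\gamma_j)_{j\in\mathbb{N}}\subset(0,1)$ and $\gamma<1$ with $\gamma_j\le\gamma$ for all $j\ge1$ such that $$D_{j+1}^2\le\gamma_{j+1}D_j^2\qquad\text{for all } j\ge0 .$$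
   Context: $X,Y$ are real Hilbert spaces with inner products $(\cdot,\cdot)_X,(\cdot,\cdot)_Y$, identified with their duals. $F:Y\to\mathbb{R}\cup\{+\infty\}$ and $G:X\to\mathbb{R}\cup\{+\infty\}$ are convex, proper and lower semicontinuous, and $B:X\to Y$ is a bounded linear operator, with adjoint $B'$, such that $u\mapsto F(Bu)+G(u)$ is proper and coercive. For $\tau>0$, $$\mathcal{L}_\tau(u,p;\lambda)=F(p)+G(u)+(\lambda,Bu-p)_Y+\frac{\tau}{2}\|Bu-p\|_Y^2 ,$$ and $(u,p;\lambda)\in X\times Y\times Y$ is a saddle point of $\mathcal{L}_\tau$ if $\mathcal{L}_\tau(u,p;\mu)\le\mathcal{L}_\tau(u,p;\lambda)\le\mathcal{L}_\tau(v,q;\lambda)$ for all $(v,q,\mu)\in X\times Y\times Y$. It is assumed that a saddle point exists. $\nabla G(v)\in X$ denotes the representative of $G'(v)$: $(\nabla G(v),w)_X=G'(v)[w]$ for all $w\in X$. Lipschitz continuity means $\|\nabla G(v)-\nabla G(v')\|_X\le L_G\|v-v'\|_X$ for all $v,v'\in X$. Strong convexity with coercivity constant $\alpha_G$ means $(\nabla G(v),w-v)_X+G(v)+\alpha_G\|w-v\|_X^2\le G(w)$ for all $v,w\in X$. Generalized ADMM: choose $(u^0,\lambda^0)\in X\times Y$ with $G(u^0)<\infty$, $\overline{\tau}\ge\underline{\tau}>0$, and set $\tau_1=\overline{\tau}$. For $j=1,2,\dots$: compute a minimizer $p^j\in Y$ of $p\mapsto\mathcal{L}_{\tau_j}(u^{j-1},p;\lambda^{j-1})$;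 compute a minimizer $u^j\in X$ of $u\mapsto\mathcal{L}_{\tau_j}(u,p^j;\lambda^{j-1})$ (minimizers are assumed to exist); set $\lambda^j=\lambda^{j-1}+\tau_j(Bu^j-p^j)$; choose $\tau_{j+1}\in[\underline{\tau},\overline{\tau}]$. The iterates are regarded as an infinite sequence (the stopping test is ignored). By convention $\tau_0:=\tau_1$. *)

(* Defs.v *)
From HB Require Import structures.
From mathcomp Require Import all_boot all_order all_algebra.
From mathcomp Require Import all_classical all_reals all_analysis.

Set Implicit Arguments.
Unset Strict Implicit.
Unset Printing Implicit Defensive.

Import Order.TTheory GRing.Theory Num.Theory.
Import numFieldNormedType.Exports.

Local Open Scope classical_set_scope.
Local Open Scope ring_scope.

HB.mixin Record CompleteNormedModule_isHilbert (R : realType) H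
    of CompleteNormedModule R H := {
  inner : {dot H for idfun};
  inner_norm : forall x : H, inner x x = `|x| ^+ 2
}.

#[short(type="hilbertType")]
HB.structure Definition Hilbert (R : realType) :=
  {H of CompleteNormedModule R H & CompleteNormedModule_isHilbert R H}.

Notation "''[' u , v ]" := (inner u%R v%R) : ring_scope.

Section extended_real_valued_functions.
Context {R : realType} {V : normedModType R}.
Implicit Type f : V -> \bar R.

Definition proper_fun f := (forall x, -oo < f x)%E /\ (exists x, f x < +oo)%E.

(* For [t = 0, 1] the convention [0 * +oo = 0] makes the inequality trivial;
   [+oo + -oo] does not occur for a proper function. *)
Definition econvex f := forall (x y : V) (t : R), 0 <= t <= 1 ->
  (f (t *: x + (1 - t) *: y)%R <= t%:E * f x + (1 - t)%:E * f y)%E.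

Definition coercive f := forall M : R, exists r : R, forall x : V,
  r <= `|x| -> (M%:E <= f x)%E.

Definition frechet_differentiable f :=
  (forall x, f x \is a fin_num) /\ (forall x, differentiable (fine \o f) x).

Definition is_minimizer {T : Type} (f : T -> \bar R) (x : T) :=
  forall y, (f x <= f y)%E.

End extended_real_valued_functions.

Section hilbert.
Context {R : realType}.

(* [g] is the Riesz representative of the derivative of [f], at every point. *)
Definition is_gradient {X : hilbertType R} (f : X -> \bar R) (g : X -> X) :=
  forall v w : X, '[g v, w] = 'd (fine \o f) v w.

Definition strongly_convex {X : hilbertType R} (f : X -> \bar R)
    (gradf : X -> X) (alpha : R) :=
  forall v w : X,
    ('[gradf v, w - v]%:E + f v + (alpha * `|w - v| ^+ 2)%:E <= f w)%E.

Definition is_adjoint {X Y : hilbertType R} (B : X -> Y) (B' : Y -> X) :=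
  forall (v : X) (mu : Y), '[B v, mu] = '[v, B' mu].

End hilbert.

Section admm.
Context {R : realType} {X Y : hilbertType R}.
Variables (F : Y -> \bar R) (G : X -> \bar R) (B : X -> Y).

Definition augmented_lagrangian (tau : R) (u : X) (p lam : Y) : \bar R :=
  (F p + G u + ('[lam, B u - p] + tau / 2 * `|B u - p| ^+ 2)%:E)%E.

Definition saddle_point (tau : R) (u : X) (p lam : Y) :=
  forall (v : X) (q mu : Y),
    (augmented_lagrangian tau u p mu <= augmented_lagrangian tau u p lam)%E /\
    (augmented_lagrangian tau u p lam <= augmented_lagrangian tau v q lam)%E.

(* The algorithm defines neither [p 0], which is unconstrained here, nor
   [tau 0], which is [tau 1] by convention. *)
Definition generalized_admm (taulo tauhi : R)
    (u : nat -> X) (p lam : nat -> Y) (tau : nat -> R) :=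
  [/\ (G (u 0%N) < +oo)%E,
      0 < taulo <= tauhi,
      tau 1%N = tauhi,
      tau 0%N = tau 1%N &
      forall j : nat,
        [/\ is_minimizer
              (fun q => augmented_lagrangian (tau j.+1) (u j) q (lam j))
              (p j.+1),
            is_minimizer
              (fun v => augmented_lagrangian (tau j.+1) v (p j.+1) (lam j))
              (u j.+1),
            lam j.+1 = lam j + tau j.+1 *: (B (u j.+1) - p j.+1) &
            taulo <= tau j.+2 <= tauhi]].

(* The squared error [D_j ^ 2] relative to the saddle point [(u, p; lam)]. *)
Definition admm_error2 (u : X) (lam : Y)
    (us : nat -> X) (lams : nat -> Y) (taus : nat -> R) (j : nat) : R :=
  `|lam - lams j| ^+ 2 + taus j ^+ 2 * `|B (u - us j)| ^+ 2.

End admm.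

(* Main.v *)
(* Optimality gives [lam^j + tau_j B (u^(j-1) - u^j)] in the subdifferential of
   [F] at [p^j] and [gradG u^j = - B' lam^j], and likewise [lam], [- B' lam] at
   the saddle point, where [B u = p]. Monotonicity of both operators, the second
   one strong, yields
     D_j^2 + 4 tau_j alphaG |u^j - u|^2 <= D_(j-1)^2
   because [tau_j <= tau_(j-1)]. Only the optimality conditions of step [j] are
   involved, so an arbitrary [(u^0, lam^0)] causes no exception at the first
   step. Conversely [alphaB |lam^j - lam| <= |gradG u^j - gradG u|] and the
   boundedness of [B] bound [D_j^2] by [C |u^j - u|^2], so the contraction factor
   [1 / (1 + 4 taulo alphaG / C)] works for every [j]. *)
Require Import Defs.
From mathcomp Require Import all_boot all_order all_algebra.
From mathcomp Require Import all_classical all_reals all_analysis.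
From mathcomp Require Import sesquilinear lra.

Set Implicit Arguments.
Unset Strict Implicit.
Unset Printing Implicit Defensive.

Import Order.TTheory GRing.Theory Num.Theory.
Import numFieldNormedType.Exports.

Local Open Scope classical_set_scope.
Local Open Scope ring_scope.

Section inner_product.
Context {R : realType} {H : hilbertType R}.
Implicit Types x y z : H.

Lemma innerC x y : '[x, y] = '[y, x].
Proof. by have := hermC (@inner R H) x y; rewrite expr0 mul1r. Qed.

Lemma innerDl x y z : '[x + y, z] = '[x, z] + '[y, z].
Proof. by rewrite linearDl. Qed.

Lemma innerDr x y z : '[z, x + y] = '[z, x] + '[z, y].
Proof. by rewrite linearD. Qed.

Lemma innerNl x y : '[- x, y] = - '[x, y].
Proof. by rewrite linearNl. Qed.

Lemma innerNr x y : '[x, - y] = - '[x, y].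
Proof. by rewrite linearN. Qed.

Lemma innerZl (k : R) x y : '[k *: x, y] = k * '[x, y].
Proof. by rewrite linearZl_LR. Qed.

Lemma innerZr (k : R) x y : '[x, k *: y] = k * '[x, y].
Proof. by rewrite innerC innerZl innerC. Qed.

Definition innerE := (innerDl, innerDr, innerNl, innerNr, innerZl, innerZr).

Lemma inner_ge0 x : 0 <= '[x, x].
Proof. by rewrite inner_norm exprn_ge0. Qed.

Lemma inner_eq0 x : '[x, x] <= 0 -> x = 0.
Proof.
rewrite inner_norm => x0; apply/eqP; rewrite -normr_eq0 -sqrf_eq0.
by rewrite eq_le x0 exprn_ge0.
Qed.

Lemma innerI x y : (forall z, '[x, z] = '[y, z]) -> x = y.
Proof.
move=> xy; apply/eqP; rewrite -subr_eq0; apply/eqP/inner_eq0.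
by rewrite innerDl innerNl xy subrr.
Qed.

(** Cauchy-Schwarz: for nonzero [x], [y], the squared norm of [|y| x - |x| y] equals [2 |x| |y| (|x|
    |y| - '[x, y])]. *)
Lemma inner_le_norm x y : '[x, y] <= `|x| * `|y|.
Proof.
have [->|x0] := eqVneq x 0; first by rewrite linear0l normr0 mul0r.
have [->|y0] := eqVneq y 0; first by rewrite linear0 normr0 mulr0.
have xy_gt0 : 0 < `|x| * `|y| by rewrite mulr_gt0 ?normr_gt0.
rewrite -(ler_pM2l xy_gt0).
have := inner_ge0 (`|y| *: x - `|x| *: y).
rewrite !innerE (innerC y x) !inner_norm.
move: '[x, y] `|x| `|y| => a b c; lra.
Qed.

(* The slack in this inequality is [t ^+ 2 * `|U' - P| ^+ 2]. *)
Lemma multiplier_update_descent (t c : R) (a a' U U' P : H) : 0 < t ->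
  a = a' + t *: (U - P) -> c <= '[a, P - U] - t * '[U - U', P] ->
  `|a| ^+ 2 + t ^+ 2 * `|U| ^+ 2 + 2 * t * c
    <= `|a'| ^+ 2 + t ^+ 2 * `|U'| ^+ 2.
Proof.
move=> t0 aE; have -> : a' = a - t *: (U - P) by rewrite aE addrK.
rewrite -(ler_pM2l t0).
have := mulr_ge0 (sqr_ge0 t) (inner_ge0 (U' - P)).
rewrite -!inner_norm !innerE.
rewrite (innerC U a) (innerC P a) (innerC P U) (innerC P U').
move: '[a, a] '[a, U] '[a, P] '[U, U] '[U, P] '[P, P] '[U', U'] '[U', P].
move=> *; lra.
Qed.

End inner_product.

(** Stands in for the limit [t -> 0] when first-order conditions are extracted from minimality along
    a segment. *)
Lemma ge0_of_affine_ge0 (R : realType) (a b : R) :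
  (forall t, 0 < t <= 1 -> 0 <= a + t * b) -> 0 <= a.
Proof.
move=> h; have [//|a0] := leP 0 a; exfalso.
have n0 : 0 < `|b| + 1 - a by have := normr_ge0 b; lra.
(* At this [t] one has [a + t * b <= a + t * |b| = - t * (1 - a) < 0]. *)
have t01 : 0 < - a / (`|b| + 1 - a) <= 1.
  rewrite divr_gt0 ?oppr_gt0//= ler_pdivrMr// mul1r.
  by have := normr_ge0 b; lra.
have := h _ t01.
have : - a / (`|b| + 1 - a) * b <= - a / (`|b| + 1 - a) * `|b|.
  by rewrite ler_wpM2l ?ler_norm// ltW//; case/andP: t01.
have : - a / (`|b| + 1 - a) * (`|b| + 1 - a) = - a by rewrite divfK// gt_eqF.
have/andP[t0 _] := t01; set t := - a / _ in t0 *.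
nra.
Qed.

Section real_valued_parts.
Context {R : realType} {X Y : hilbertType R}.
Variables (F : Y -> \bar R) (G : X -> \bar R) (B : {linear X -> Y}).

Lemma strongly_convex_fine (gradG : X -> X) (alpha : R) :
  (forall v, G v \is a fin_num) -> strongly_convex G gradG alpha ->
  forall v w, '[gradG v, w - v] + fine (G v) + alpha * `|w - v| ^+ 2
    <= fine (G w).
Proof.
by move=> Gfin sG v w; rewrite -lee_fin !EFinD !fineK//; exact: sG.
Qed.

(** Comparison with a point of the effective domain of [F] rules out the value [+oo]. *)
Lemma minimizer_dual_fin_num (tau : R) (u : X) (p lam : Y) :
  proper_fun F -> G u \is a fin_num ->
  is_minimizer (fun q => augmented_lagrangian F G B tau u q lam) p ->
  F p \is a fin_num.
Proof.
move=> [FNy [q Fq]] Gu /(_ q); rewrite /augmented_lagrangian.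
have : F q \is a fin_num by rewrite fin_numE gt_eqF//= lt_eqF.
have := FNy p; move: Gu.
by case: (G u) => // g _; case: (F q) => // fq; case: (F p).
Qed.

(** Minimality is tested at [p + t (q - p)] and [F] there is bounded by convexity. After division by
    [t] the penalty leaves only the error [t * tau / 2 * |q - p|^2], which vanishes with [t]. *)
Lemma minimizer_dual_subgradient (tau : R) (u : X) (p lam q : Y) :
  proper_fun F -> econvex F -> G u \is a fin_num ->
  is_minimizer (fun q => augmented_lagrangian F G B tau u q lam) p ->
  F q \is a fin_num ->
  fine (F p) + '[lam + tau *: (B u - p), q - p] <= fine (F q).
Proof.
move=> pF cF Gu pmin Fq.
have Fp := minimizer_dual_fin_num pF Gu pmin.
rewrite -subr_ge0; apply: (@ge0_of_affine_ge0 _ _ (tau / 2 * `|q - p| ^+ 2)).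
move=> t /andP[t0 t1].
have t01 : 0 <= t <= 1 by rewrite ltW.
have /= := cF q p t t01; have := pmin (t *: q + (1 - t) *: p).
have -> : t *: q + (1 - t) *: p = p + t *: (q - p).
  by rewrite scalerBr scalerBl scale1r addrCA.
rewrite /augmented_lagrangian; set F' := F (p + _).
move: Gu Fp Fq (pF.1 (p + t *: (q - p))); rewrite -/F'.
case: (G u) => // g _; case: (F p) => // fp _; case: (F q) => // fq _.
case: F' => // f' _.
rewrite -!EFinM -!EFinD !lee_fin /= -!inner_norm.
have -> : B u - (p + t *: (q - p)) = (B u - p) - t *: (q - p).
  by rewrite opprD addrA.
move: (B u - p) (q - p) => r s.
rewrite !innerE (innerC s r).
move: '[lam, r] '[lam, s] '[r, r] '[r, s] '[s, s] => a b c d e h1 h2.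
have : 0 <= t * (fq - (fp + (b + tau * d)) + t * (tau / 2 * e)) by nra.
by rewrite pmulr_rge0.
Qed.

(** Minimality is tested at [u + t w]. The gradient inequality based at [u + t w] gives [G (u + t w)
    - G u <= t '[gradG (u + t w), w]], and the Lipschitz bound moves the gradient back to [u] at a
    cost of order [t^2]. *)
Lemma minimizer_primal_gradient (gradG : X -> X) (LG : R)
    (tau : R) (u : X) (p lam : Y) :
  (forall v, G v \is a fin_num) ->
  (forall v w, '[gradG v, w - v] + fine (G v) <= fine (G w)) ->
  LG.-lipschitz gradG ->
  F p \is a fin_num ->
  is_minimizer (fun v => augmented_lagrangian F G B tau v p lam) u ->
  forall w, '[gradG u, w] = - '[lam + tau *: (B u - p), B w].
Proof.
move=> Gfin subG lipG Fp umin.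
(* Both sides are linear in [w], so replacing [w] by [- w] turns the inequality into an equality. *)
suff ge0 w : 0 <= '[gradG u, w] + '[lam + tau *: (B u - p), B w].
  move=> w; apply/eqP; rewrite -addr_eq0 eq_le ge0 andbT.
  by have := ge0 (- w); rewrite (linearN B) !innerNr; lra.
pose D := LG * `|w| ^+ 2.
apply: (@ge0_of_affine_ge0 _ _ (D + tau / 2 * `|B w| ^+ 2)).
move=> t /andP[t0 t1].
have := umin (u + t *: w); have := subG (u + t *: w) u.
rewrite /augmented_lagrangian.
move: Fp (Gfin u) (Gfin (u + t *: w)).
case: (F p) => // f _; case: (G u) => // g _.
case: (G (u + t *: w)) => // g' _; rewrite /= -!EFinD !lee_fin.
have -> : u - (u + t *: w) = - (t *: w) by rewrite opprD addNKr.
have -> : B (u + t *: w) - p = B u - p + t *: B w.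
  by rewrite (linearD B) (linearZZ B) addrAC.
have D_ge : '[gradG (u + t *: w) - gradG u, w] <= t * D.
  have lip : `|gradG (u + t *: w) - gradG u| <= LG * `|t *: w|.
    have := lipG (u + t *: w, u) (conj I I).
    by rewrite /= [in leRHS]addrC addKr.
  rewrite (le_trans (inner_le_norm _ _))// (le_trans (ler_wpM2r _ lip))//.
  by rewrite normrZ gtr0_norm// /D; lra.
rewrite -!inner_norm.
move: (B u - p) (B w) D_ge => r s.
rewrite !innerE (innerC s r).
set g1 := '[gradG (_ + _), w]; set g0 := '[gradG u, w].
move: '[lam, r] '[lam, s] '[r, r] '[r, s] '[s, s] => a b c d e h0 h1 h2.
have : 0 <= t * (g0 + (b + tau * d) + t * (D + tau / 2 * e)) by nra.
by rewrite pmulr_rge0.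
Qed.

End real_valued_parts.

Theorem theorem3p14 (R : realType) (X Y : hilbertType R)
    (F : Y -> \bar R) (G : X -> \bar R)
    (B : {linear X -> Y}) (B' : Y -> X)
    (gradG : X -> X) (LG alphaG alphaB : R)
    (tau : R) (u : X) (p lam : Y)
    (taulo tauhi : R) (us : nat -> X) (ps lams : nat -> Y) (taus : nat -> R) :
  proper_fun F -> econvex F -> lower_semicontinuous F ->
  proper_fun G -> econvex G -> lower_semicontinuous G ->
  bounded_near B (nbhs 0) -> is_adjoint B B' ->
  proper_fun (fun v : X => F (B v) + G v)%E ->
  coercive (fun v : X => F (B v) + G v)%E ->
  frechet_differentiable G -> is_gradient G gradG ->
  0 < LG -> LG.-lipschitz gradG ->
  0 < alphaG -> strongly_convex G gradG alphaG ->
  0 < alphaB -> (forall mu : Y, alphaB * `|mu| <= `|B' mu|) ->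
  0 < tau -> saddle_point F G B tau u p lam ->
  generalized_admm F G B taulo tauhi us ps lams taus ->
  (forall j : nat,
     [/\ taulo <= taus j.+1, taus j.+1 <= taus j & taus j <= tauhi]) ->
  exists (gamma_ : nat -> R) (gamma : R),
    [/\ (forall j : nat, 0 < gamma_ j < 1),
        gamma < 1,
        (forall j : nat, (1 <= j)%N -> gamma_ j <= gamma) &
        (forall j : nat,
           admm_error2 B u lam us lams taus j.+1
             <= gamma_ j.+1 * admm_error2 B u lam us lams taus j)].
Proof.
move=> pF cF _ _ _ _ bB adjB _ _ [Gfin _] _ LG0 lipG aG0 sG aB0 B'_ge _
  saddle [_ /andP[taulo0 _] _ _ iter] taumono.
have sGf := strongly_convex_fine Gfin sG.
have subG v w : '[gradG v, w - v] + fine (G v) <= fine (G w).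
  by apply: le_trans (sGf v w); rewrite lerDl mulr_ge0 ?(ltW aG0) ?exprn_ge0.
have [K K0 BK] : exists2 K, 0 < K & forall x, `|B x| <= K * `|x|.
  by have /linear_boundedP/pinfty_ex_gt0[K K0 BK] := bB; exists K.
have pmin : is_minimizer (fun q => augmented_lagrangian F G B tau u q lam) p.
  by move=> q; have [] := saddle u q lam.
have umin : is_minimizer (fun v => augmented_lagrangian F G B tau v p lam) u.
  by move=> v; have [] := saddle v p lam.
have Fp := minimizer_dual_fin_num pF (Gfin u) pmin.
have BuE : B u = p.
  apply/eqP; rewrite -subr_eq0; apply/eqP/inner_eq0.
  (* Shifting the multiplier by the residual changes the Lagrangian by exactly [|B u - p|^2], which
     maximality in the multiplier forces to be nonpositive. *)
  have [+ _] := saddle u p (lam + (B u - p)).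
  rewrite /augmented_lagrangian; move: Fp (Gfin u).
  case: (F p) => // f _; case: (G u) => // g _.
  by rewrite -!EFinD lee_fin innerDl; lra.
have gradu w : '[gradG u, w] = - '[lam, B w].
  have := minimizer_primal_gradient Gfin subG lipG Fp umin w.
  by rewrite BuE subrr scaler0 addr0.
have subF q : F q \is a fin_num -> fine (F p) + '[lam, q - p] <= fine (F q).
  move/(minimizer_dual_subgradient pF cF (Gfin u) pmin).
  by rewrite BuE subrr scaler0 addr0.
have tau_gt0 j : 0 < taus j.+1.
  by have [+ _ _] := taumono j; apply: lt_le_trans.
(* The multiplier in the primal optimality condition of this step is exactly the updated
   [lams j.+1]. *)
have gradus j w : '[gradG (us j.+1), w] = - '[lams j.+1, B w].
  have [pjmin ujmin -> _] := iter j.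
  have Fpj := minimizer_dual_fin_num pF (Gfin _) pjmin.
  exact: minimizer_primal_gradient Gfin subG lipG Fpj ujmin w.
pose d j := `|us j - u| ^+ 2.
pose err := admm_error2 B u lam us lams taus.
have descent j : err j.+1 + 4 * taulo * alphaG * d j.+1 <= err j.
  have [pjmin _ lamE _] := iter j.
  have [tlo tdecr _] := taumono j.
  have Fpj := minimizer_dual_fin_num pF (Gfin _) pjmin.
  have hF1 := subF _ Fpj.
  have hF2 := minimizer_dual_subgradient pF cF (Gfin _) pjmin Fp.
  have hG1 := sGf u (us j.+1).
  have hG2 := sGf (us j.+1) u.
  rewrite gradu in hG1; rewrite gradus in hG2.
  rewrite (distrC u) -/(d _) in hG2; rewrite -/(d _) in hG1.
  (* Sum of the four inequalities: all values of [F] and [G] cancel, and strong convexity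
     contributes [alphaG] twice. The subgradient at [ps j.+1] uses the old [us j], so it differs
     from [lams j.+1] by [taus j.+1 * B (us j.+1 - us j)], whence the last term. *)
  have monotone : 2 * alphaG * d j.+1 <=
      '[lams j.+1 - lam, (ps j.+1 - p) - (B (us j.+1) - p)]
      - taus j.+1 * '[(B (us j.+1) - p) - (B (us j) - p), ps j.+1 - p].
    move: hF1 hF2 hG1 hG2; rewrite !(linearB B) lamE BuE !innerE.
    move: (d j.+1) => e; lra.
  have lamjE : lams j.+1 - lam = lams j - lam
      + taus j.+1 *: ((B (us j.+1) - p) - (ps j.+1 - p)).
    by rewrite lamE addrAC opprB [in RHS]addrA subrK.
  have := multiplier_update_descent (tau_gt0 j) lamjE monotone.
  rewrite /err /admm_error2 !(linearB B) BuE !(distrC lam) !(distrC p).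
  have d0 : 0 <= alphaG * d j.+1 by rewrite mulr_ge0 ?(ltW aG0) ?exprn_ge0.
  have := ler_wpM2r d0 tlo.
  (* The descent lemma weights the old primal error by [taus j.+1], whereas [err j] carries
     [taus j]; monotonicity of the step sizes closes the gap. *)
  have : taus j.+1 ^+ 2 * `|B (us j) - p| ^+ 2
      <= taus j ^+ 2 * `|B (us j) - p| ^+ 2.
    rewrite ler_wpM2r ?exprn_ge0// lerXn2r// nnegrE ltW//.
    exact: lt_le_trans tdecr.
  lra.
(* The first summand bounds the multiplier error through [B'] and the Lipschitz gradient, the second
   the weighted primal error through [K]. *)
pose C := (LG / alphaB) ^+ 2 + (tauhi * K) ^+ 2.
have err_le j : err j.+1 <= C * d j.+1.
  have [_ _ thi] := taumono j.+1.
  have lam_le : `|lam - lams j.+1| <= LG / alphaB * `|us j.+1 - u|.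
    rewrite mulrAC ler_pdivlMr// mulrC (le_trans (B'_ge _))//.
    have -> : B' (lam - lams j.+1) = gradG (us j.+1) - gradG u.
      apply: innerI => w; rewrite innerC -adjB innerC !innerE gradu gradus.
      by rewrite opprK addrC.
    exact: (lipG (us j.+1, u) (conj I I)).
  have Bu_le : taus j.+1 * `|B (u - us j.+1)| <= tauhi * K * `|us j.+1 - u|.
    by rewrite -mulrA ler_pM// ?(ltW (tau_gt0 j))// distrC BK.
  rewrite /err /admm_error2 /C /d mulrDl -!exprMn lerD// lerXn2r// nnegrE.
  - exact: normr_ge0.
  - by rewrite mulr_ge0// ltW// divr_gt0.
  - by rewrite mulr_ge0// (ltW (tau_gt0 j)).
  - by rewrite !mulr_ge0// ?(ltW K0)// (le_trans _ thi)// ltW.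
have C0 : 0 < C.
  by rewrite ltr_wpDr ?sqr_ge0// exprn_gt0// divr_gt0.
(* Chosen so that [c * C] is the coefficient in [descent]; with [err_le] this gives
   [(1 + c) * err j.+1 <= err j]. *)
pose c := 4 * taulo * alphaG / C.
have c0 : 0 < c by rewrite divr_gt0// !mulr_gt0.
have g0 : 0 < (1 + c)^-1 by rewrite invr_gt0 addr_gt0.
have g1 : (1 + c)^-1 < 1 by rewrite invf_lt1 ?ltrDl// addr_gt0.
exists (fun=> (1 + c)^-1), (1 + c)^-1; split=> // [j|j]; first by rewrite g0.
rewrite -ler_pdivrMl// invrK mulrDl mul1r.
apply: le_trans (descent j); rewrite lerD2l.
rewrite /c mulrAC ler_pdivrMr// -[leRHS]mulrA ler_pM2l ?mulr_gt0//.
by rewrite [leRHS]mulrC; exact: err_le.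
Qed.
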